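(* Let $\mathbb F$ be a field of characteristic $p>0$, let $\mathcal P$ be a reduced operad in $\mathbb F$-vector spaces, and let $A$ be a $\Gamma(\mathcal P)$-algebra. Then the operations $\beta_{x,\underline r}$ of $A$ (for all $\underline r=(r_1,\dots,r_s)\in\mathrm{Comp}_s(n)$ and $x\in\mathcal P(n)^{\Sigma_{\underline r}}$) are generated by the family of those operations $\beta_{x,\underline r}$ for which all the integers $r_i$ are powers of $p$ (including $p^0=1$). That is, every operation $\beta_{x,\underline r}:A^{\times s}\to A$ belongs to the smallest collection of maps $A^{\times k}\to A$ ($k\ge 0$) which contains the operations $\beta_{y,\underline q}$ with all $q_i$ powers of $p$, contains all coordinate projections, and is closed under composition and under $\mathbb F$-linear combinations.
   Context: **Divided power algebras over an operad.** $\mathcal P$ is a symmetric operad in $\mathbb F$-vector spaces, reduced means $\mathcal P(0)=0$; $1_{\mathcal P}\in\mathcal P(1)$ is the unit. $[n]=\{1,\dots,n\}$. $\Sigma_n$ acts on the left on $\mathcal P(n)$, normalised so that in $\mathcal P$-algebras $(\sigma\cdot x)(a_1,\dots,a_n)=x(a_{\sigma(1)},\dots,a_{\sigma(n)})$. $x(x_1,\dots,x_n)$ is operadic composition, and $y^{\times k}$ denotes $y,\dots,y$ ($k$ times). If $x$ is invariant under a subgroup $H\subset G$, $\sum_{\sigma\in G/H}\sigma\cdot x$ is the sum over coset representatives. $\mathrm{Comp}_s(n)$ is the set of $\underline r=(r_1,\dots,r_s)\in\mathbb Z_{\ge 0}^s$ with $r_1+\dots+r_s=n$, identified with the ordered partition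 of $[n]$ into consecutive intervals of lengths $r_1,\dots,r_s$. For an ordered partition $R=(R_1,\dots,R_s)$ of $[n]$ into possibly empty subsets, $\Sigma_R=\{\sigma\in\Sigma_n:\sigma(R_i)=R_i\ \forall i\}$; in particular $\Sigma_{\underline r}=\Sigma_{r_1}\times\dots\times\Sigma_{r_s}$. Notation: - $\underline r\circ_i\underline q$, for $\underline q\in \mathrm{Comp}(r_i)$: replace the entry $r_i$ by the entries of $\underline q$. - $\underline q\rhd\underline r\in\mathrm{Comp}_{s'}(n)$, for $\underline r\in\mathrm{Comp}_s(n)$, $\underline q\in\mathrm{Comp}_{s'}(s)$: its $i$-th entry is the sum of the $r_j$ with $j$ in the $i$-th interval of $\underline q$. - $\underline r^\rho=(r_{\rho^{-1}(1)},\dots,r_{\rho^{-1}(s)})$ for $\rho\in\Sigma_s$, and $\rho^*\in\Sigma_n$ is the block permutation carrying the $i$-th interval of $\underline r$ order-preservingly onto the $\rho(i)$-th interval of $\underline r^\rho$. - $\underline r\diamond(\underline q_i)_{i\in[s]}$, for $\underline q_i\in\mathrm{Comp}_{k_i}(m_i)$: cut $[\sum_i r_im_i]$ into consecutive intervals, first $r_1$ of length $m_1$, then $r_2$ of length $m_2$, etc.; the block with index $(i,j)$ ($i\in[s]$, $j\in[k_i]$, lexicographic order) is the union over the $r_i$ intervals of length $m_i$ of their $j$-th sub-interval with respect to $\underline q_i$. - $\Sigma_{r_i}\wr\Sigma_{\underline q_i}\subset\Sigma_{r_im_i}$: permutations of the $r_i$ intervals combined with elements of $\Sigma_{\underline q_i}$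 in each interval. - For an arbitrary ordered partition $R$ and $x\in\mathcal P(n)^{\Sigma_R}$, $\beta_{x,R}:=\beta_{\tau_R\cdot x,(|R_1|,\dots,|R_s|)}$, where $\tau_R\in\Sigma_n$ maps $R_1,R_2,\dots$ order-preservingly onto consecutive intervals. A $\Gamma(\mathcal P)$-algebra (algebra over Fresse's monad $\Gamma(\mathcal P,V)=\bigoplus_{n>0}(\mathcal P(n)\otimes V^{\otimes n})^{\Sigma_n}$) is equivalently, and may be taken by definition to be, an $\mathbb F$-vector space $A$ with maps $\beta_{x,\underline r}:A^{\times s}\to A$ for all $\underline r\in\mathrm{Comp}_s(n)$, $x\in\mathcal P(n)^{\Sigma_{\underline r}}$, such that: (β1) $\beta_{x,\underline r}((a_i)_i)=\beta_{\rho^*\cdot x,\underline r^\rho}((a_{\rho^{-1}(i)})_i)$ for $\rho\in\Sigma_s$; (β2) $\beta_{x,(0,r_1,\dots,r_s)}(a_0,a_1,\dots,a_s)=\beta_{x,(r_1,\dots,r_s)}(a_1,\dots,a_s)$; (β3) $\beta_{x,\underline r}(\lambda a_1,a_2,\dots,a_s)=\lambda^{r_1}\beta_{x,\underline r}(a_1,\dots,a_s)$ for $\lambda\in\mathbb F$; (β4) for $\underline q\in\mathrm{Comp}_{s'}(s)$: $\beta_{x,\underline r}(\underbrace{a_1,\dots,a_1}_{q_1},\dots,\underbrace{a_{s'},\dots,a_{s'}}_{q_{s'}})=\beta_{\sum_{\sigma\in\Sigma_{\underline q\rhd\underline r}/\Sigma_{\underline r}}\sigma\cdot x,\ \underline q\rhd\underline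 r}(a_1,\dots,a_{s'})$; (β5) $\beta_{x,\underline r}(a_0+a_1,a_2,\dots,a_s)=\sum_{l+m=r_1}\beta_{x,\underline r\circ_1(l,m)}(a_0,a_1,\dots,a_s)$; (β6) $\beta_{\lambda x+y,\underline r}=\lambda\beta_{x,\underline r}+\beta_{y,\underline r}$; (β7) $\beta_{1_{\mathcal P},(1)}(a)=a$; (β8) for $x_i\in\mathcal P(m_i)^{\Sigma_{\underline q_i}}$, $\underline q_i\in\mathrm{Comp}_{k_i}(m_i)$, $b_i\in A^{\times k_i}$: $\beta_{x,\underline r}(\beta_{x_1,\underline q_1}(b_1),\dots,\beta_{x_s,\underline q_s}(b_s))=\beta_{\sum_\tau\tau\cdot x(x_1^{\times r_1},\dots,x_s^{\times r_s}),\ \underline r\diamond(\underline q_i)_i}(b_1,\dots,b_s)$, $\tau$ ranging over $\Sigma_{\underline r\diamond(\underline q_i)}/\prod_i\Sigma_{r_i}\wr\Sigma_{\underline q_i}$. *)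

(* Defs.v *)
From mathcomp Require Import all_boot all_order all_fingroup all_algebra.

Set Implicit Arguments.
Unset Strict Implicit.
Unset Printing Implicit Defensive.

Import GRing.Theory.
Local Open Scope ring_scope.

(* All index sets [n] = {1, ..., n} are replaced by 'I_n = {0, ..., n-1}.
   In 'S_n the product s * t is "first s, then t", i.e. t \o s. *)

(* Tuples (a_1, ..., a_s) are finite functions; tcons is (a_0, a_1, ..., a_s). *)
Definition tcons (T : Type) s (a0 : T) (a : {ffun 'I_s -> T}) :
    {ffun 'I_s.+1 -> T} :=
  [ffun i => oapp a a0 (unlift ord0 i)].

(* An ordered partition (R_i)_i of [n] into s possibly empty blocks is given by
   the function R : 'I_n -> 'I_s sending k to the index of its block. *)
Section OrderedPartitions.
Variables (n s : nat).

Definition young (R : 'I_n -> 'I_s) : {set 'S_n} :=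
  [set g : 'S_n | [forall k, R (g k) == R k]].

Definition sort_lt (R : 'I_n -> 'I_s) (k' k : 'I_n) : bool :=
  (R k' < R k)%N || (R k' == R k) && (k' < k)%N.

Lemma sort_rank_subproof (R : 'I_n -> 'I_s) (k : 'I_n) :
  (#|[set k' | sort_lt R k' k]| < n)%N.
Proof.
rewrite -[X in (_ < X)%N]card_ord -cardsT; apply: proper_card.
rewrite properT; apply/eqP => /setP/(_ k).
by rewrite !inE /sort_lt !ltnn andbF.
Qed.

Definition sort_rank (R : 'I_n -> 'I_s) (k : 'I_n) : 'I_n :=
  Ordinal (sort_rank_subproof R k).

Lemma sort_rank_inj (R : 'I_n -> 'I_s) : injective (sort_rank R).
Proof.
have ltP k1 k2 : sort_lt R k1 k2 -> (sort_rank R k1 < sort_rank R k2)%N.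
  move=> lt12; apply: proper_card; apply/properP; split.
    apply/subsetP => k; rewrite !inE; move: lt12; rewrite /sort_lt.
    case/orP=> [l12|/andP[/eqP e12 l12]].
      case/orP=> [lk|/andP[/eqP ek lk]]; first by rewrite (ltn_trans lk l12).
      by rewrite ek l12.
    by rewrite e12 => /orP[->//|/andP[-> lk]]; rewrite (ltn_trans lk l12) orbT.
  by exists k1; rewrite !inE // /sort_lt !ltnn andbF.
move=> k1 k2 e12; apply/eqP; apply: contraT => ne12.
have : sort_lt R k1 k2 || sort_lt R k2 k1.
  rewrite /sort_lt; case: (ltngtP (R k1) (R k2)) => [//|_|/val_inj ->] /=.
    by rewrite orbT.
  by rewrite !eqxx /= -neq_ltn.
by case/orP=> /ltP; rewrite e12 ltnn.
Qed.

(* tau_R: maps the blocks R_1, R_2, ... order-preservingly onto consecutive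
   intervals, so that k is sent to its rank for the order "first by block, then
   by value". *)
Definition sort_perm (R : 'I_n -> 'I_s) : 'S_n := perm (@sort_rank_inj R).

End OrderedPartitions.

(* Comp_s(n). *)
Record composition (s n : nat) := Composition {
  parts :> {ffun 'I_s -> nat};
  parts_sum : (\sum_i parts i == n)%N
}.

(* The index of the interval containing a given element of [n]. *)
Definition block_index s n (r : composition s n) (k : 'I_n) : 'I_s :=
  tagnat.sig1 (cast_ord (esym (eqP (parts_sum r))) k).

Section Compositions.
Local Open Scope nat_scope.

Lemma sum_tcons s (a : nat) (r : {ffun 'I_s -> nat}) :
  \sum_i tcons a r i = a + \sum_i r i.
Proof.
rewrite big_ord_recl ffunE unlift_none; congr (_ + _).
by apply: eq_bigr => i _; rewrite ffunE liftK.
Qed.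

Lemma comp1_subproof n : \sum_i [ffun _ : 'I_1 => n] i == n.
Proof. by rewrite big_ord1 ffunE. Qed.

(* (n) *)
Definition comp1 n : composition 1 n := Composition (comp1_subproof n).

Lemma comp0cons_subproof s n (r : composition s n) : \sum_i tcons 0 r i == n.
Proof. by rewrite sum_tcons (eqP (parts_sum r)). Qed.

(* (0, r_1, ..., r_s) *)
Definition comp0cons s n (r : composition s n) : composition s.+1 n :=
  Composition (comp0cons_subproof r).

Lemma comp_perm_subproof s n (r : composition s n) (rho : 'S_s) :
  \sum_i [ffun i => r ((rho^-1)%g i)] i == n.
Proof.
rewrite -[X in _ == X](eqP (parts_sum r)).
rewrite [X in _ == X](reindex_inj (@perm_inj _ rho^-1%g)).
by apply/eqP/eq_bigr => i _; rewrite ffunE.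
Qed.

(* r^rho *)
Definition comp_perm s n (r : composition s n) (rho : 'S_s) : composition s n :=
  Composition (comp_perm_subproof r rho).

Lemma comp_split_subproof s n (r : composition s.+1 n) (l : 'I_(r ord0).+1) :
  \sum_i tcons (l : nat) (tcons (r ord0 - l) [ffun i => r (lift ord0 i)]) i == n.
Proof.
rewrite !sum_tcons addnA subnKC; last by rewrite -ltnS.
rewrite -[X in _ == X](eqP (parts_sum r)) [X in _ == X]big_ord_recl eqn_add2l.
by apply/eqP/eq_bigr => i _; rewrite ffunE.
Qed.

(* r o_1 (l, m) with l + m = r_1 *)
Definition comp_split s n (r : composition s.+1 n) (l : 'I_(r ord0).+1) :
    composition s.+2 n :=
  Composition (comp_split_subproof l).

Lemma comp_merge_subproof s' s n (q : composition s' s) (r : composition s n) :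
  \sum_i [ffun i => \sum_(j | block_index q j == i) r j] i == n.
Proof.
rewrite -[X in _ == X](eqP (parts_sum r)).
rewrite [X in _ == X](partition_big (block_index q) xpredT) //=.
by apply/eqP/eq_bigr => i _; rewrite ffunE.
Qed.

(* q |> r *)
Definition comp_merge s' s n (q : composition s' s) (r : composition s n) :
    composition s' n :=
  Composition (comp_merge_subproof q r).

Lemma block_sizes_subproof s n (R : 'I_n -> 'I_s) :
  \sum_i [ffun i => #|[set k | R k == i]|] i == n.
Proof.
rewrite -[X in _ == X]card_ord -sum1_card.
rewrite [X in _ == X](partition_big R xpredT) //=.
apply/eqP/eq_bigr => i _; rewrite ffunE -sum1_card.
by apply: eq_bigl => k; rewrite inE.
Qed.

(* (|R_1|, ..., |R_s|) *)
Definition block_sizes s n (R : 'I_n -> 'I_s) : composition s n :=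
  Composition (block_sizes_subproof R).

End Compositions.

(* rho^*: the ordered partition whose rho(i)-th block is the i-th interval of r
   is sorted by the block permutation carrying the i-th interval of r onto the
   rho(i)-th interval of r^rho. *)
Definition block_perm s n (r : composition s n) (rho : 'S_s) : 'S_n :=
  sort_perm (fun k => rho (block_index r k)).

(* g_1 (+) ... (+) g_n acting on consecutive intervals of lengths m_1, ..., m_n. *)
Section SumPerm.
Variables (n : nat) (m : 'I_n -> nat) (g : forall i, 'S_(m i)).

Definition sum_perm_fun (k : 'I_(\sum_i m i)) : 'I_(\sum_i m i) :=
  tagnat.Rank _ (g (tagnat.sig1 k) (tagnat.sig2 k)).

Lemma sum_perm_inj : injective sum_perm_fun.
Proof.
apply: (can_inj (g := fun k =>
  tagnat.Rank _ (((g (tagnat.sig1 k))^-1)%g (tagnat.sig2 k)))) => k.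
rewrite /sum_perm_fun /tagnat.sig1 /tagnat.sig2 /tagnat.Rank !tagnat.rankK /=.
by rewrite permK -tagnat.sigE12 tagnat.sigK.
Qed.

Definition sum_perm : 'S_(\sum_i m i) := perm sum_perm_inj.

End SumPerm.

(* Symmetric operads in F-vector spaces. The composite x(y_1, ..., y_n) has arity
   m_1 + ... + m_n; equalities between elements whose arities are only provably
   equal are stated in the total space {n : nat & P n}. *)
Record operad (F : fieldType) := Operad {
  op_mod :> nat -> lmodType F;
  op_act : forall n, 'S_n -> op_mod n -> op_mod n;
  op_one : op_mod 1;
  op_comp : forall n (m : 'I_n -> nat),
    op_mod n -> (forall i, op_mod (m i)) -> op_mod (\sum_i m i);

  op_act_linear : forall n (g : 'S_n) (c : F) (x y : op_mod n),
    op_act g (c *: x + y) = c *: op_act g x + op_act g y;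
  op_act1 : forall n (x : op_mod n), op_act 1%g x = x;
  op_actM : forall n (g h : 'S_n) (x : op_mod n),
    op_act (h * g)%g x = op_act g (op_act h x);

  op_comp_linearl : forall n (m : 'I_n -> nat) (c : F) (x x' : op_mod n)
      (y : forall i, op_mod (m i)),
    op_comp (c *: x + x') y = c *: op_comp x y + op_comp x' y;
  op_comp_linearr : forall n (m : 'I_n -> nat) (x : op_mod n)
      (y : forall i, op_mod (m i)) (i : 'I_n) (c : F) (z z' : op_mod (m i)),
    op_comp x (dfwith y (c *: z + z'))
    = c *: op_comp x (dfwith y z) + op_comp x (dfwith y z');

  op_comp1l : forall n (x : op_mod n),
    Tagged op_mod (op_comp op_one (fun _ : 'I_1 => x)) = Tagged op_mod x;
  op_comp1r : forall n (x : op_mod n),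
    Tagged op_mod (op_comp x (fun _ : 'I_n => op_one)) = Tagged op_mod x;
  op_compA : forall n (m : 'I_n -> nat) (l : 'I_(\sum_i m i) -> nat)
      (x : op_mod n) (y : forall i, op_mod (m i)) (z : forall k, op_mod (l k)),
    Tagged op_mod (op_comp (op_comp x y) z)
    = Tagged op_mod
        (op_comp x (fun i => op_comp (y i) (fun j => z (tagnat.Rank i j))));

  (* (g . x)(b_1, ..., b_n) = x(b_g(1), ..., b_g(n)) for b_i = y_i(a_i1, a_i2, ...) *)
  op_comp_actl : forall n (m : 'I_n -> nat) (g : 'S_n) (x : op_mod n)
      (y : forall i, op_mod (m i)),
    Tagged op_mod (op_comp (op_act g x) y)
    = Tagged op_mod
        (op_act
           (sort_perm (fun k : 'I_(\sum_i m (g i)) => g (tagnat.sig1 k)))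
           (op_comp x (fun i => y (g i))));
  op_comp_actr : forall n (m : 'I_n -> nat) (x : op_mod n)
      (g : forall i, 'S_(m i)) (y : forall i, op_mod (m i)),
    op_comp x (fun i => op_act (g i) (y i)) = op_act (sum_perm g) (op_comp x y)
}.

Definition reduced (F : fieldType) (P : operad F) : Prop :=
  forall x : P 0%N, x = 0.

Section Invariants.
Variables (F : fieldType) (P : operad F).

Definition fixed_by n (H : {set 'S_n}) (x : P n) : Prop :=
  forall g, g \in H -> op_act g x = x.

(* The sum over g in G/H of g . x. The cosets g \o H are the right cosets H :* g,
   since products in 'S_n are composed from left to right. *)
Definition coset_sum n (G H : {set 'S_n}) (x : P n) : P n :=
  \sum_(C in rcosets H G) op_act (repr C) x.

End Invariants.

Section Diamond.
Variables (s n : nat) (r : composition s n) (k m : 'I_s -> nat).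
Variable q : forall i, composition (k i) (m i).

(* The arity of x(x_1^{r_1}, ..., x_s^{r_s}); tagnat.sig1 z is the interval of z
   and tagnat.sig2 z the position of z in it. *)
Definition diamond_arity : nat := \sum_(l < n) m (block_index r l).

(* The ordered partition r <> (q_i)_i; the pair (i, j) has index tagnat.Rank i j. *)
Definition diamond (z : 'I_diamond_arity) : 'I_(\sum_i k i) :=
  tagnat.Rank _ (block_index (q (block_index r (tagnat.sig1 z))) (tagnat.sig2 z)).

(* The product of the wreath products Sigma_{r_i} wr Sigma_{q_i}: a permutation g of
   the intervals preserving their type i, combined with h l in Sigma_{q_i} on the
   l-th interval. *)
Definition wreath : {set 'S_diamond_arity} :=
  [set t : 'S_diamond_arity | [exists g in young (block_index r),
    [exists h : {dffun forall l : 'I_n, 'S_(m (block_index r l))},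
      [forall l, h l \in young (block_index (q (block_index r l)))]
      && [forall z, (tagnat.sig1 (t z) == g (tagnat.sig1 z))
            && (tagnat.sig2 (t z) == h (tagnat.sig1 z) (tagnat.sig2 z) :> nat)]]]].

End Diamond.

Arguments diamond {s n} r {k m} q z.
Arguments wreath {s n} r {k m} q.

Section GammaAlgebra.
Variables (F : fieldType) (P : operad F) (A : lmodType F).

Definition family_beta := forall s n, composition s n -> P n -> {ffun 'I_s -> A} -> A.

(* beta_{x, R} for an arbitrary ordered partition R *)
Definition beta_part (beta : family_beta) s n (R : 'I_n -> 'I_s) (x : P n) :
    {ffun 'I_s -> A} -> A :=
  beta s n (block_sizes R) (op_act (sort_perm R) x).

(* beta r x is meaningful only for x invariant under Sigma_r: nothing is required
   of its values for the other x. *)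
Record gamma_algebra := GammaAlgebra {
  beta : family_beta;

  beta_perm : forall s n (r : composition s n) (x : P n) (rho : 'S_s)
      (a : {ffun 'I_s -> A}),
    fixed_by (young (block_index r)) x ->
    beta r x a
    = beta (comp_perm r rho) (op_act (block_perm r rho) x) [ffun i => a ((rho^-1)%g i)];

  beta_zero : forall s n (r : composition s n) (x : P n) (a0 : A)
      (a : {ffun 'I_s -> A}),
    fixed_by (young (block_index r)) x ->
    beta (comp0cons r) x (tcons a0 a) = beta r x a;

  beta_scale : forall s n (r : composition s.+1 n) (x : P n) (c : F) (a1 : A)
      (a : {ffun 'I_s -> A}),
    fixed_by (young (block_index r)) x ->
    beta r x (tcons (c *: a1) a) = c ^+ r ord0 *: beta r x (tcons a1 a);

  beta_merge : forall s' s n (q : composition s' s) (r : composition s n) (x : P n)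
      (a : {ffun 'I_s' -> A}),
    fixed_by (young (block_index r)) x ->
    beta r x [ffun j => a (block_index q j)]
    = beta (comp_merge q r)
        (coset_sum (young (block_index (comp_merge q r))) (young (block_index r)) x) a;

  beta_add : forall s n (r : composition s.+1 n) (x : P n) (a0 a1 : A)
      (a : {ffun 'I_s -> A}),
    fixed_by (young (block_index r)) x ->
    beta r x (tcons (a0 + a1) a)
    = \sum_(l < (r ord0).+1) beta (comp_split l) x (tcons a0 (tcons a1 a));

  beta_linear : forall s n (r : composition s n) (c : F) (x y : P n)
      (a : {ffun 'I_s -> A}),
    fixed_by (young (block_index r)) x -> fixed_by (young (block_index r)) y ->
    beta r (c *: x + y) a = c *: beta r x a + beta r y a;

  beta_one : forall a : A, beta (comp1 1) (op_one P) [ffun _ => a] = a;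

  beta_comp : forall s n (r : composition s n) (x : P n) (k m : 'I_s -> nat)
      (q : forall i, composition (k i) (m i)) (y : forall i, P (m i))
      (b : forall i, {ffun 'I_(k i) -> A}),
    fixed_by (young (block_index r)) x ->
    (forall i, fixed_by (young (block_index (q i))) (y i)) ->
    beta r x [ffun i => beta (q i) (y i) (b i)]
    = beta_part beta (diamond r q)
        (coset_sum (young (diamond r q)) (wreath r q)
           (op_comp x (fun l => y (block_index r l))))
        [ffun j => b (tagnat.sig1 j) (tagnat.sig2 j)]
}.

(* A collection of maps A^k -> A, k >= 0. *)
Definition collection := forall k, ({ffun 'I_k -> A} -> A) -> Prop.

(* Maps are identified when they are pointwise equal. *)
Inductive clone_gen (G : collection) : collection :=
| clone_base k f : G k f -> clone_gen G f
| clone_ext k (f g : {ffun 'I_k -> A} -> A) :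
    f =1 g -> clone_gen G f -> clone_gen G g
| clone_proj k (i : 'I_k) : clone_gen G (fun a : {ffun 'I_k -> A} => a i)
| clone_comp k l (f : {ffun 'I_l -> A} -> A) (g : 'I_l -> {ffun 'I_k -> A} -> A) :
    clone_gen G f -> (forall i, clone_gen G (g i)) ->
    clone_gen G (fun a => f [ffun i => g i a])
| clone_lin k l (c : 'I_l -> F) (g : 'I_l -> {ffun 'I_k -> A} -> A) :
    (forall i, clone_gen G (g i)) -> clone_gen G (fun a => \sum_i c i *: g i a).

(* The operations beta_{y, q} with all q_i powers of p. *)
Inductive power_ops (p : nat) (B : gamma_algebra) : collection :=
| PowerOp k n (q : composition k n) (y : P n) :
    (forall i, exists e, q i = (p ^ e)%N) ->
    fixed_by (young (block_index q)) y -> power_ops p B (beta B q y).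

End GammaAlgebra.

(* Main.v *)
Require Import Defs.
From mathcomp Require Import all_boot all_order all_fingroup all_algebra.

(** Write each [r_i] as a sum of powers of [p], following its base [p] digits,
    and let [r'] be the resulting composition of [n], so that [r = q |> r'] for
    the composition [q] that counts the powers used for each [r_i]. As
    [Sigma_r'] is contained in [Sigma_r], an element [x] fixed by [Sigma_r] is
    also fixed by [Sigma_r'], and the relation for repeated arguments
    ([beta_merge]) computes [beta_(x, r')] on the tuple in which the [i]-th
    argument is repeated [q_i] times. The result is [beta_(y, r)], where [y] is
    the sum of [g . x] over [g] in [Sigma_r / Sigma_r']; each term equals [x],
    so [y] is [N x] with [N] the index of [Sigma_r'] in [Sigma_r]
    ([coset_sum_fixed]).

    This index is a product of multinomial coefficients
    [r_i! / \prod_j r'_j!], and the choice of base [p] digits makes each of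
    them prime to [p] ([power_partition]); in other words [Sigma_r'] contains a
    Sylow [p]-subgroup of [Sigma_r]. So [N] is invertible in the field, and
    [beta_(x, r)] is [1 / N] times the operation [beta_(x, r')], all of whose
    parts are powers of [p], composed with coordinate projections. *)

Import GRing.Theory.
Local Open Scope ring_scope.

(** * Factorials and base p digits *)

(** By Legendre's formula, the claim compares [m %/ p ^ j] with the sum of the
    corresponding quotients of [p ^ e] and [m - p ^ e] for each [j]: for
    [j <= e] the division of [p ^ e] is exact, and for [j > e] all three
    quotients vanish. Equivalently, ['C(m, p ^ e)] is prime to [p]. *)
Lemma logn_fact_greedy (p m e : nat) : prime p -> (p ^ e <= m < p ^ e.+1)%N ->
  logn p m`! = (logn p (p ^ e)`! + logn p (m - p ^ e)`!)%N.
Proof.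
move=> pr_p /andP[le_em lt_me].
(* Legendre's sum for [k] has zero terms from [k.+1] on, so that the three
   sums can be taken over the same range. *)
have wide k : (k <= m)%N ->
    logn p k`! = (\sum_(1 <= j < m.+1) k %/ p ^ j)%N.
  move=> le_km; rewrite logn_fact // [RHS](@big_cat_nat _ _ _ k.+1) //=.
  rewrite [X in (_ + X)%N]big_nat_cond [X in (_ + X)%N]big1 ?addn0 //.
  move=> j /andP[/andP[lt_kj _] _]; apply: divn_small.
  by rewrite (ltn_trans lt_kj) // ltn_expl // prime_gt1.
rewrite !wide ?leq_subr // -big_split; apply: eq_bigr => j _ /=.
have [le_je | lt_ej] := leqP j e.
  by rewrite -divnDl ?dvdn_exp2l // subnKC.
have lt_m: (m < p ^ j)%N.
  by rewrite (leq_trans lt_me) // leq_pexp2l // prime_gt0.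
by rewrite !divn_small // (leq_ltn_trans _ lt_m) // leq_subr.
Qed.

(** Removing the largest power of [p] again and again produces each power
    [p ^ e] as often as the [e]-th digit of [m] says. The last condition says
    that the multinomial coefficient of this partition is prime to [p]. *)
Lemma power_partition (p m : nat) : prime p ->
  exists l : seq nat, [/\ forall k, k \in l -> exists e, k = (p ^ e)%N,
    sumn l = m & (logn p m`! = \sum_(k <- l) logn p k`!)%N].
Proof.
move=> pr_p; elim/ltn_ind: m => -[|m] IHm.
  by exists [::]; rewrite big_nil fact0 logn1.
have p_gt1 := prime_gt1 pr_p.
have bnd := trunc_log_bounds p_gt1 (ltn0Sn m).
set e := trunc_log p m.+1 in bnd; have /andP[le_e _] := bnd.
have pe_gt0 : (0 < p ^ e)%N by rewrite expn_gt0 ltnW.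
have [|l [l_pow l_sum l_log]] := IHm (m.+1 - p ^ e)%N.
  by rewrite ltn_subrL pe_gt0.
exists (p ^ e :: l)%N; split=> [k | |].
- by rewrite inE => /predU1P[-> | /l_pow //]; exists e.
- by rewrite /= l_sum subnKC.
- by rewrite big_cons -l_log; apply: logn_fact_greedy.
Qed.

Lemma logn_prod (p : nat) (I : finType) (F : I -> nat) :
    (forall i, 0 < F i)%N ->
  logn p (\prod_i F i) = (\sum_i logn p (F i))%N.
Proof.
move=> F_gt0; suff /andP[_ /eqP] : (0 < \prod_i F i)%N
  && (logn p (\prod_i F i) == \sum_i logn p (F i))%N by [].
elim/big_rec2: _ => [|i m1 m2 _ /andP[m2_gt0 /eqP <-]]; first by rewrite logn1.
by rewrite muln_gt0 F_gt0 m2_gt0 lognM ?eqxx.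
Qed.

(** * Young subgroups and their orders *)

(** By induction on [m]: the permutations of the top level [R = m - 1] form a
    direct factor, whose complement is the same group for [m - 1]. The bound
    on the support is what lets one peel off the levels one at a time. *)
Lemma card_level_stab (T : finType) (R : T -> nat) (m : nat) :
  #|[set g : {perm T} | [forall x, R (g x) == R x]
                        && perm_on [set x | (R x < m)%N] g]|
  = (\prod_(i < m) #|[set x | R x == i]|`!)%N.
Proof.
pose Y m := [set g : {perm T} | [forall x, R (g x) == R x]
                        && perm_on [set x | (R x < m)%N] g].
have Ygrp k : group_set (Y k).
  apply/group_setP; split=> [|g h].
    by rewrite inE perm_on1 andbT; apply/forallP=> x; rewrite perm1.
  rewrite !inE => /andP[/forallP Rg Sg] /andP[/forallP Rh Sh].
  rewrite perm_onM // andbT; apply/forallP=> x.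
  by rewrite permM (eqP (Rh _)).
elim: m => [|m IHm].
  rewrite big_ord0; apply/eqP/cards1P; exists 1%g; apply/setP=> g.
  rewrite !inE; apply/andP/eqP=> [[_ Sg] | ->].
    by apply/permP=> x; rewrite perm1 (out_perm Sg) // inE.
  by split; [apply/forallP=> x; rewrite perm1 | apply: perm_on1].
rewrite big_ord_recr /= -IHm mulnC -/(Y m) -/(Y m.+1).
rewrite -(card_Sym [set x | R x == m]).
rewrite -(TI_cardMg (G := Sym_group _) (H := Group (Ygrp m))) /=.
  congr #|pred_of_set _|; apply/setP=> g; apply/idP/mulsgP.
    rewrite inE => /andP[/forallP Rg Sg].
    set L := [set x | R x == m].
    have nLg : g \in 'N(L | 'P)%g.
      apply/astabsP=> x; rewrite !inE /= apermE.
      by rewrite (eqP (Rg x)).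
    have Sr := restr_perm_on L g.
    pose h := restr_perm L g.
    have hL x : x \in L -> h x = g x by move=> Lx; rewrite /h restr_permE.
    (* [g] is the product of its restriction [h] to the level [L] and of a
       permutation that is trivial on [L] and agrees with [g] elsewhere. *)
    exists h (h^-1 * g)%g; rewrite ?mulKVg ?inE //.
    have hV x : x \in L -> (h^-1 * g)%g x = x.
      move=> Lx; rewrite permM; have Lx' : (h^-1)%g x \in L.
        by rewrite perm_closed ?perm_onV.
      by rewrite -hL // permKV.
    have hN x : x \notin L -> (h^-1 * g)%g x = g x.
      by move=> Lx; rewrite permM (out_perm (perm_onV Sr)).
    apply/andP; split.
      apply/forallP=> x; have [Lx | Lx] := boolP (x \in L).
        by rewrite hV.
      by rewrite hN.
    apply/subsetP=> x; rewrite !inE; have [Lx | Lx] := boolP (x \in L).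
      by rewrite hV ?eqxx.
    rewrite hN // => gx; have := subsetP Sg x; rewrite !inE gx => /(_ isT).
    by rewrite ltnS leq_eqVlt; move: Lx; rewrite inE => /negPf->.
  case=> h k; rewrite !inE => Sh /andP[/forallP Rk Sk] ->.
  apply/andP; split.
    apply/forallP=> x; rewrite permM (eqP (Rk _)).
    have [Lx | Lx] := boolP (x \in [set x | R x == m]).
      by move: Lx (Lx); rewrite -{1}(perm_closed x Sh) !inE => /eqP-> /eqP->.
    by rewrite (out_perm Sh).
  apply: perm_onM.
    by apply: subset_trans Sh _; apply/subsetP=> x; rewrite !inE => /eqP->.
  by apply: subset_trans Sk _; apply/subsetP=> x; rewrite !inE; apply: ltnW.
apply/setP=> g; rewrite !inE; apply/and3P/eqP=> [[Sg _ Sg'] | ->]; last first.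
  by rewrite !perm_on1; split=> //; apply/forallP=> x; rewrite perm1.
apply/permP=> x; rewrite perm1.
have [Rx | Rx] := eqVneq (R x) m; last by rewrite (out_perm Sg) // inE.
by rewrite (out_perm Sg') // inE Rx ltnn.
Qed.

Lemma card_young (n s : nat) (R : 'I_n -> 'I_s) :
  #|young R| = (\prod_(i < s) #|[set k | R k == i]|`!)%N.
Proof.
have <- := card_level_stab 'I_n (fun k => R k : nat) s.
apply: eq_card => g; rewrite !inE; apply/idP/andP=> [Rg | [Rg _] //].
by split=> //; apply/subsetP=> k _; rewrite inE.
Qed.

Lemma young_group_set (n s : nat) (R : 'I_n -> 'I_s) :
  group_set (young R).
Proof.
apply/group_setP; split=> [|g h].
  by rewrite inE; apply/forallP=> k; rewrite perm1.
rewrite !inE => /forallP Rg /forallP Rh; apply/forallP=> k.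
by rewrite permM (eqP (Rh _)).
Qed.

Canonical young_group (n s : nat) (R : 'I_n -> 'I_s) :=
  Group (young_group_set n s R).

(** * Intervals of a composition *)

Lemma big_tagnat_block (s : nat) (m : 'I_s -> nat) (i : 'I_s)
    (F : 'I_(\sum_i m i) -> nat) :
  (\sum_(j | tagnat.sig1 j == i) F j = \sum_(k < m i) F (tagnat.Rank i k))%N.
Proof.
rewrite (reindex _ (onW_bij _ tagnat.rank_bij)).
pose T := {i : 'I_s & 'I_(m i)}.
rewrite (eq_bigl (fun t : T => (tag t == i) && true)); last first.
  by move=> t; rewrite andbT /tagnat.sig1 tagnat.rankK.
rewrite (eq_bigr (fun t : T => F (tagnat.Rank (tag t) (tagged t)))); last first.
  by move=> t _; rewrite tagnat.rankE.
by rewrite -(sig_big_dep (fun i' => i' == i) (fun _ _ => true)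
  (fun i' k => F (tagnat.Rank i' k))) /= big_pred1_eq.
Qed.

Lemma card_block_index (s n : nat) (r : composition s n) (i : 'I_s) :
  #|[set k | block_index r k == i]| = r i.
Proof.
case: r => f e; have En := eqP e; subst n; rewrite -sum1dep_card.
under eq_bigl => k do rewrite /block_index cast_ord_id.
by rewrite big_tagnat_block sum1_card card_ord.
Qed.

Lemma block_index_mono {s n : nat} (r : composition s n) :
  {homo block_index r : k k' / (k <= k')%N >-> (k <= k')%N}.
Proof. by move=> k k' le_kk'; apply: tagnat.le_sig1. Qed.

(** The elements sent below [i] by a nondecreasing map form an initial segment,
    whose length is the total size of the fibres below [i]; so the sizes of the
    fibres determine the map. This gives a way to recognize [block_index]
    without computing endpoints of intervals. *)
Lemma mono_fibers_eq {s n : nat} (R R' : 'I_n -> 'I_s) :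
    {homo R : k k' / (k <= k')%N >-> (k <= k')%N} ->
    {homo R' : k k' / (k <= k')%N >-> (k <= k')%N} ->
    (forall i, #|[set k | R k == i]| = #|[set k | R' k == i]|) ->
  R =1 R'.
Proof.
have lt_card (Q : 'I_n -> 'I_s) i k :
    {homo Q : k k' / (k <= k')%N >-> (k <= k')%N} ->
    (Q k < i)%N = (k < \sum_(j < s | j < i) #|[set k | Q k == j]|)%N.
  move=> monoQ.
  have -> : (\sum_(j < s | j < i) #|[set k | Q k == j]|
             = #|[set k | Q k < i]|)%N.
    rewrite -sum1dep_card (partition_big Q (fun j : 'I_s => (j < i)%N)) //=.
    apply: eq_bigr => j lt_ji; rewrite -sum1dep_card; apply: eq_bigl => k'.
    by case: eqP => [->|]; rewrite ?lt_ji ?andbF.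
  have cardI m : (m <= n)%N -> #|[set k' : 'I_n | (k' < m)%N]| = m.
    move=> le_mn; rewrite cardsE -sum1_card.
    by rewrite -(big_ord_widen n (fun _ => 1%N)) // sum1_card card_ord.
  apply/idP/idP=> [lt_Qi | ].
    rewrite -{1}[k.+1]cardI //; apply: subset_leq_card; apply/subsetP=> k'.
    by rewrite !inE ltnS => /monoQ/leq_ltn_trans->.
  apply: contraTT; rewrite -!leqNgt => le_iQ.
  rewrite -[leqRHS](cardI k (ltnW (ltn_ord k))).
  apply: subset_leq_card; apply/subsetP=> k'.
  rewrite !inE; apply: contraTT; rewrite -!leqNgt => /monoQ.
  exact: leq_trans.
move=> monoR monoR' eqRR' k; apply/val_inj/eqP.
have eqlt i : (R k < i)%N = (R' k < i)%N.
  by rewrite !lt_card //; under eq_bigr do rewrite eqRR'.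
by rewrite eqn_leq -(ltnS (R k)) eqlt ltnSn -ltnS -eqlt ltnSn.
Qed.

Lemma card_merged_block (s' s n : nat) (q : composition s' s)
    (r : composition s n) (i : 'I_s') :
  #|[set k | block_index q (block_index r k) == i]|
  = comp_merge q r i.
Proof.
rewrite ffunE -sum1dep_card.
rewrite (partition_big (block_index r) (fun j => block_index q j == i)) //=.
apply: eq_bigr => j qj; rewrite -card_block_index -sum1dep_card.
apply: eq_bigl => k.
by case: (block_index r k =P j) => [->|]; rewrite ?qj ?andbF.
Qed.

(** Both sides are nondecreasing in [k] with fibres of equal sizes. *)
Lemma block_index_merge (s' s n : nat) (q : composition s' s)
    (r : composition s n) (k : 'I_n) :
  block_index (comp_merge q r) k
  = block_index q (block_index r k).
Proof.
apply: (mono_fibers_eq _ (block_index q \o block_index r)) => [||i].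
- exact: block_index_mono.
- by move=> k1 k2 /(block_index_mono r)/(block_index_mono q).
by rewrite card_block_index card_merged_block.
Qed.

Lemma young_merge (s' s n : nat) (q : composition s' s) (r : composition s n) :
  (young (block_index r)
     \subset young (block_index (comp_merge q r)))%g.
Proof.
apply/subsetP=> g; rewrite !inE => /forallP rg; apply/forallP=> k.
by rewrite !block_index_merge (eqP (rg k)).
Qed.

Lemma composition_inj {s n : nat} (r r' : composition s n) :
  r =1 r' -> r = r'.
Proof.
case: r r' => [f e] [f' e'] /= /ffunP eqf; subst f'.
by rewrite (bool_irrelevance e e').
Qed.

(** The parts [r'_j] run through the concatenation of the lists [l i], and [q]
    records the lengths of these lists. Testing against an arbitrary [F] says
    which multiset the parts form; it is needed for the sum of the parts and
    for the sum of the valuations of their factorials. *)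
Lemma exists_refinement {s n : nat} (r : composition s n)
    (l : 'I_s -> seq nat) :
    (forall i, sumn (l i) = r i) ->
  exists s' (q : composition s s') (r' : composition s' n),
    [/\ comp_merge q r' = r,
        forall j, exists i, r' j \in l i
      & forall F : nat -> nat,
          (\sum_j F (r' j) = \sum_i \sum_(k <- l i) F k)%N].
Proof.
move=> sum_l; pose d i := size (l i).
pose f := [ffun j : 'I_(\sum_i d i) =>
             nth 0%N (l (tagnat.sig1 j)) (tagnat.sig2 j)].
have f_block F i :
    (\sum_(j | tagnat.sig1 j == i) F (f j) = \sum_(k <- l i) F k)%N.
  rewrite big_tagnat_block (big_nth 0%N) big_mkord; apply: eq_bigr => k _.
  by rewrite ffunE tagnat.Rank2K /= tagnat.Rank1K.
have f_sum F : (\sum_j F (f j) = \sum_i \sum_(k <- l i) F k)%N.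
  rewrite (partition_big tagnat.sig1 xpredT) //=.
  by apply: eq_bigr => i _; apply: f_block.
have fn : (\sum_j f j == n)%N.
  rewrite (f_sum id) -(eqP (parts_sum r)); apply/eqP/eq_bigr=> i _.
  by rewrite -sumnE sum_l.
have dq : (\sum_i [ffun i => d i] i == \sum_i d i)%N.
  by apply/eqP/eq_bigr => i _; rewrite ffunE.
pose q := Composition dq.
have qE j : block_index q j = tagnat.sig1 j.
  apply: (mono_fibers_eq (block_index q) tagnat.sig1) => //.
  - exact: block_index_mono.
  - by move=> k k' ?; apply: tagnat.le_sig1.
  - move=> i; rewrite card_block_index ffunE -sum1dep_card.
    by rewrite big_tagnat_block sum1_card card_ord.
exists (\sum_i d i)%N, q, (Composition fn); split=> //= [|j].
  apply: composition_inj => i; rewrite ffunE /=.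
  under eq_bigl do rewrite qE.
  by rewrite (f_block id) -sumnE sum_l.
by exists (tagnat.sig1 j); rewrite ffunE mem_nth.
Qed.

Lemma logn_card_young (p s n : nat) (r : composition s n) :
  logn p #|young (block_index r)| = (\sum_i logn p (r i)`!)%N.
Proof.
rewrite card_young logn_prod => [|i]; last exact: fact_gt0.
by apply: eq_bigr => i _; rewrite card_block_index.
Qed.

(** * Sums over cosets and generation by powers of p *)

Lemma coset_sum_fixed {F : fieldType} (P : operad F) {n : nat}
    (G H : {group 'S_n}) (x : P n) :
    (H \subset G)%g -> fixed_by G x ->
  coset_sum G H x = #|G : H|%g%:R *: x.
Proof.
move=> sHG Gx; rewrite scaler_nat -sumr_const; apply: eq_bigr => C.
case/rcosetsP=> g Gg ->; apply: Gx.
have : repr (H :* g)%g \in (H :* g)%g by apply: mem_repr (rcoset_refl H g).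
by apply: subsetP; rewrite mul_subG ?sub1set.
Qed.

(** Linearity is given in the affine form [c *: x + y]; taking [y = x] and
    [c - 1] as the scalar avoids a separate treatment of [y = 0]. *)
Lemma beta_scalar {F : fieldType} {P : operad F} {A : lmodType F}
    (B : gamma_algebra P A) {s n : nat} (r : composition s n) (c : F)
    (x : P n) (a : {ffun 'I_s -> A}) :
  fixed_by (young (block_index r)) x ->
  beta B r (c *: x) a = c *: beta B r x a.
Proof.
move=> fx; have := beta_linear B (c - 1) a fx fx.
by rewrite !scalerBl !scale1r !subrK.
Qed.

Theorem proposition3p4 (F : fieldType) (p : nat) (charFp : p \in [pchar F])
    (P : operad F) (redP : reduced P) (A : lmodType F) (B : gamma_algebra P A)
    (s n : nat) (r : composition s n) (x : P n)
    (invx : fixed_by (young (block_index r)) x) :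
  clone_gen (power_ops p B) (beta B r x).
Proof.
have pr_p := pcharf_prime charFp.
have [l l_spec] := fin_all_exists (fun i => power_partition p (r i) pr_p).
have [i | s' [q [r' [qr' r'_l r'_sum]]]] := exists_refinement r l.
  by have [] := l_spec i.
have sub_young : (young (block_index r') \subset young (block_index r))%g.
  by rewrite -qr'; apply: young_merge.
have fx' : fixed_by (young (block_index r')) x.
  by move=> g /(subsetP sub_young)/invx.
pose N := #|young (block_index r) : young (block_index r')|%g.
have N_unit : N%:R != 0 :> F.
  have N_gt0 : (0 < N)%N by apply: indexg_gt0.
  have logN : logn p N = 0%N.
    apply/eqP; rewrite -(eqn_add2l (logn p #|young (block_index r')|)) addn0.
    rewrite -lognM ?cardG_gt0 // Lagrange // !logn_card_young.
    rewrite (r'_sum (fun k => logn p k`!)); apply/eqP/eq_bigr => i _.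
    by have [] := l_spec i.
  rewrite -(dvdn_pcharf charFp); move/eqP: logN.
  by rewrite eqn0Ngt logn_gt0 mem_primes pr_p N_gt0.
(* The relation for repeated arguments, solved for [beta B r x]. *)
have betaE a : beta B r x a
    = \sum_(i < 1) N%:R^-1 *: beta B r' x [ffun j => a (block_index q j)].
  rewrite big_ord1 beta_merge // qr' coset_sum_fixed // beta_scalar //.
  by rewrite scalerA mulVf // scale1r.
apply: clone_ext (fun a => esym (betaE a)) _.
apply: clone_lin => _; apply: clone_comp => [|j]; last exact: clone_proj.
apply: clone_base; apply: PowerOp => // j.
have [i] := r'_l j; have [l_pow _ _] := l_spec i; exact: l_pow.
Qed.
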